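(* Let $g(x)=\sum_{i=0}^n a_ix^i$ be a polynomial that is positive on $[0,1]$ and such that $d\nu(t)=g(t)\chi_{(0,1)}(t)\,dt$ is a probability measure. Then $\mu=\nu^2$ is absolutely continuous with respect to Lebesgue measure, with Radon-Nikodym derivative $f\cdot\chi_{(0,1)}$, where $$f(x)=\sum_{i=0}^{n-1}\left(\frac{1-x^{i+1}}{i+1}\right)\sum_{j=0}^{n-i-1}a_ja_{j+i+1}x^j\;-\;\ln x\cdot\sum_{i=0}^n a_i^2x^i\;+\;\sum_{i=-n-1}^{-2}\left(\frac{1-x^{i+1}}{i+1}\right)\sum_{j=-i-1}^{n}a_ja_{j+i+1}x^j .$$
   Context: For a positive Borel measure $\nu$ with compact support in $[0,\infty)$, $\nu^2$ denotes the unique positive compactly supported Borel measure $\mu$ on $[0,\infty)$ with $\int t^k\,d\mu(t)=\left(\int t^k\,d\nu(t)\right)^2$ for all integers $k\ge0$; equivalently $\mu=(\nu\times\nu)\circ p^{-1}$ with $p(x,y)=xy$. $\chi_E$ is the indicator function of $E$. *)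

(* Defs.v *)
From HB Require Import structures.
From mathcomp Require Import all_boot all_order all_algebra.
From mathcomp Require Import all_classical all_reals all_analysis.
From mathcomp Require Import measurable_realfun.
Set Implicit Arguments.
Unset Strict Implicit.
Unset Printing Implicit Defensive.
Import Order.TTheory GRing.Theory Num.Theory.
Import numFieldNormedType.Exports.
Local Open Scope classical_set_scope.
Local Open Scope ring_scope.

Definition compactly_supported_nonneg (R : realType)
    (mu : {measure set (measurableTypeR R) -> \bar R}) : Prop :=
  exists K : set R,
    [/\ compact K, K `<=` `[0, +oo[ & mu (~` K) = 0%E].

(* mu is nu^2. A predicate rather than a function of nu: a library measure is a
   function on all subsets, unconstrained off the sigma-algebra, so the moments
   determine mu on Borel sets only. [is_square_mulp] below gives existence. *)
Definition is_square (R : realType)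
    (nu mu : {measure set (measurableTypeR R) -> \bar R}) : Prop :=
  compactly_supported_nonneg mu /\
  forall k : nat,
    (\int[mu]_t (t ^+ k)%:E = (\int[nu]_t (t ^+ k)%:E) ^+ 2)%E.

(* In the last sum m stands for -i, where i runs from -n-1 to -2; thus
   i + 1 = 1 - m is a negative exponent, -i - 1 = m.-1, and the index j + i + 1
   is the natural number j.+1 - m, the subtraction being exact for
   m.-1 <= j. *)
Definition square_density (R : realType) (n : nat) (a : nat -> R) (x : R) : R :=
  \sum_(0 <= i < n) ((1 - x ^+ i.+1) / i.+1%:R *
      \sum_(0 <= j < n - i) a j * a (j + i + 1)%N * x ^+ j)
  - ln x * \sum_(0 <= i < n.+1) a i ^+ 2 * x ^+ i
  + \sum_(2 <= m < n.+2) ((1 - x ^ (1 - m%:Z)) / (1 - m%:R) *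
      \sum_(m.-1 <= j < n.+1) a j * a (j.+1 - m)%N * x ^+ j).

Section product_convolution.
Local Open Scope ereal_scope.
Context (R : realType).
Local Notation B := (measurableTypeR R).

Definition mulp (z : B * B) : B := (z.1 * z.2)%R.

Lemma measurable_mulp : measurable_fun setT mulp.
Proof. exact: (measurable_funM measurable_fst measurable_snd). Qed.

Lemma measurable_exp_norm (k : nat) :
  measurable_fun setT (fun t : B => (`|t| ^+ k)%:E).
Proof.
apply/measurable_EFinP; apply: (@measurable_funX _ B R setT (fun t => `|t|%R)).
exact: measurableT_comp.
Qed.

Lemma measurable_exp (k : nat) :
  measurable_fun setT (fun t : B => (t ^+ k)%:E).
Proof. by apply/measurable_EFinP; exact: (@measurable_funX _ B R setT id). Qed.

Lemma moment_norm (mu : {measure set B -> \bar R}) (k : nat) :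
  compactly_supported_nonneg mu ->
  \int[mu]_t (t ^+ k)%:E = \int[mu]_t (`|t| ^+ k)%:E.
Proof.
move=> [K [cK K0 muK]]; apply: ae_eq_integral => //.
- exact: measurable_exp.
- exact: measurable_exp_norm.
exists (~` K); split => //.
  by apply: measurableC; exact: compact_measurable.
move=> t /= + Kt; apply => _.
by have := K0 _ Kt; rewrite /= in_itv/= andbT => t0; rewrite ger0_norm.
Qed.

Variable nu : {finite_measure set B -> \bar R}.

Lemma is_square_mulp : compactly_supported_nonneg nu ->
  exists2 mu : {finite_measure set B -> \bar R},
    is_square nu mu &
    forall A, measurable A -> mu A = (nu \x nu) (mulp @^-1` A).
Proof.
move=> nuc.
pose m0 := pushforward (nu \x nu) mulp : {measure set B -> \bar R}.
pose m := m0 measurable_mulp.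
have nuT : (nu \x nu) setT < +oo.
  rewrite -setXTT product_measure1E// -ge0_fin_numE ?mule_ge0//.
  by rewrite fin_numM// fin_num_measure.
have mfin : fin_num_fun m.
  move=> A mA; rewrite ge0_fin_numE//; apply: le_lt_trans nuT.
  change ((nu \x nu) (mulp @^-1` A) <= (nu \x nu) setT).
  apply: le_measure; rewrite ?inE// -[X in measurable X]setTI.
  exact: measurable_mulp.
pose Mfin := Measure_isFinite.Build _ _ _ m mfin.
pose mu : {finite_measure set B -> \bar R} := HB.pack (Measure.sort m) Mfin.
have muc : compactly_supported_nonneg mu.
  have [K [cK K0 nuK]] := nuc.
  have mK : measurable (~` K : set B).
    by apply: measurableC; exact: compact_measurable.
  have [M [_ /(_ (M + 1)%R)]] := compact_bounded cK.
  rewrite ltrDl ltr01 => /(_ isT) KM.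
  exists `[0%R, ((M + 1) ^+ 2)%R]%classic; split.
  - exact: segment_compact.
  - by move=> x /=; rewrite !in_itv/= => /andP[->].
  apply/eqP; rewrite eq_le measure_ge0 andbT.
  have e1 : (nu \x nu) (~` K `*` setT) = 0.
    by rewrite product_measure1E// nuK mul0e.
  have e2 : (nu \x nu) (setT `*` ~` K) = 0.
    by rewrite product_measure1E// nuK mule0.
  have mKT : measurable (~` K `*` setT : set (B * B)) by exact: measurableX.
  have mTK : measurable (setT `*` ~` K : set (B * B)) by exact: measurableX.
  have U0 : (nu \x nu) (~` K `*` setT `|` setT `*` ~` K) = 0.
    by rewrite null_set_setU.
  change ((nu \x nu) (mulp @^-1` (~` `[0%R, ((M + 1) ^+ 2)%R])) <= 0).
  rewrite -U0.
  apply: le_measure; rewrite ?inE.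
  - rewrite -[X in measurable X]setTI; apply: measurable_mulp => //.
    by apply: measurableC.
  - by apply: measurableU; exact: measurableX.
  move=> [x y] /= nxy.
  have [Kx|] := pselect (K x); last by left.
  have [Ky|] := pselect (K y); last by right.
  exfalso; apply: nxy; rewrite /mulp/= in_itv/=.
  have := K0 _ Kx; have := K0 _ Ky; rewrite /= !in_itv/= !andbT => y0 x0.
  have := KM _ Kx; have := KM _ Ky; rewrite /= !ger0_norm// => yM xM.
  by rewrite mulr_ge0//= expr2 ler_pM.
exists mu => //; split => // k.
rewrite !moment_norm//.
have -> : \int[mu]_t (`|t| ^+ k)%:E =
    \int[nu \x nu]_z (`|z.1| ^+ k * `|z.2| ^+ k)%:E.
  rewrite (ge0_integral_pushforward measurable_mulp)//.
  - by rewrite preimage_setT; apply: eq_integral => z _ /=; rewrite normrM exprMn.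
  - exact: measurable_exp_norm.
rewrite fubini_tonelli1//=; last first.
  apply/measurable_EFinP; apply: measurable_funM; apply/measurable_EFinP.
    exact: (measurableT_comp (measurable_exp_norm k) measurable_fst).
  exact: (measurableT_comp (measurable_exp_norm k) measurable_snd).
have mk := measurable_exp_norm k.
have I0 : 0 <= \int[nu]_t (`|t| ^+ k)%:E.
  by apply: integral_ge0 => t _; rewrite lee_fin exprn_ge0.
transitivity (\int[nu]_x ((`|x| ^+ k)%:E * \int[nu]_t (`|t| ^+ k)%:E)).
  apply: eq_integral => x _; rewrite /fubini_F/=.
  under eq_integral do rewrite EFinM.
  by rewrite ge0_integralZl.
by rewrite ge0_integralZr.
Qed.

End product_convolution.

(* Main.v *)
(* On (0,1) the density is the double sum of a_j a_k phi_jk, where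
   phi_jk = (x^j - x^k) / (k - j), read as - x^j ln x when j = k, has p-th moment
   1 / ((p+j+1) (p+k+1)). Hence the density and nu^2 have the same moments, and
   it remains to see that a finite measure m on [0,M] is determined by moments.
   For a threshold c and an integer k with k c >= M, the polynomials
   (1 - (t / (k c))^n)^(n k^n) are bounded by 1 on [0,M] and converge pointwise
   to the indicator of [0,c[, so dominated convergence gives m [0,c[. The
   passage from such intervals to Borel sets compares the positive measures
   m + f^- and f^+, f being the density. *)
Require Import Defs.
From HB Require Import structures.
From mathcomp Require Import all_boot all_order all_algebra.
From mathcomp Require Import all_classical all_reals all_analysis.
From mathcomp Require Import measurable_realfun.
From mathcomp Require Import ring lra zify.
Set Implicit Arguments.
Unset Strict Implicit.
Unset Printing Implicit Defensive.
Import Order.TTheory GRing.Theory Num.Theory.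
Import numFieldNormedType.Exports.
Local Open Scope classical_set_scope.
Local Open Scope ring_scope.
Local Open Scope charge_scope.

(** * Limits of powers and the polynomial cutoff *)

Section limits.
Context {R : realType}.
Implicit Types x y z : R.

Lemma bernoulli_ineq x n : -1 <= x -> 1 + n%:R * x <= (1 + x) ^+ n.
Proof.
move=> x1; have x1' : 0 <= 1 + x by lra.
elim: n => [|n IH]; first by rewrite expr0; lra.
rewrite exprS; apply: le_trans (ler_wpM2l x1' IH).
have : 0 <= n%:R * x ^+ 2 by rewrite mulr_ge0// sqr_ge0.
by rewrite -natr1; nra.
Qed.

(** Half of the decay suffices to absorb n: with [w = sqrt z], Bernoulli at [w^-1] bounds [n w^n] by
    a constant, and the remaining factor [w^n] is geometric. *)
Lemma cvg_natM_expr z : 0 < z < 1 -> n%:R * z ^+ n @[n --> \oo] --> 0.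
Proof.
move=> /andP[z0 z1].
pose w := Num.sqrt z.
have w0 : 0 < w by rewrite sqrtr_gt0.
have w1 : w < 1 by rewrite -sqrtr1 ltr_sqrt.
have h0 : 0 < w^-1 - 1 by rewrite subr_gt0 invf_gt1.
apply: (@squeeze_cvgr _ _ _ _ (fun=> 0) (geometric (w^-1 - 1)^-1 w)).
- apply: nearW => n; rewrite mulr_ge0//= ?exprn_ge0 ?(ltW z0)//.
  rewrite -(sqr_sqrtr (ltW z0)) -/w exprAC expr2 mulrA.
  rewrite ler_wpM2r ?exprn_ge0 ?(ltW w0)//.
  rewrite -[leRHS]mul1r ler_pdivlMr//.
  have /(bernoulli_ineq n) : -1 <= w^-1 - 1 by lra.
  rewrite subrKC exprVn -[leRHS]div1r ler_pdivlMr ?exprn_gt0//.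
  have : 0 < w ^+ n by rewrite exprn_gt0.
  nra.
- exact: cvg_cst.
- by apply: cvg_geometric; rewrite gtr0_norm.
Qed.

(* The exponent [n * k ^ n] rather than [k ^ n] makes the limit vanish also at
   the threshold [k * y = 1]. *)
Lemma cvg_cutoff (k : nat) y : 0 <= y <= 1 ->
  (1 - y ^+ n) ^+ (n * k ^ n) @[n --> \oo] --> ((k%:R * y < 1)%R%:R : R).
Proof.
move=> /andP[y0 y1].
have yn n : 0 <= y ^+ n <= 1 by rewrite exprn_ge0//= exprn_ile1.
have e n : (n * k ^ n)%:R * y ^+ n = n%:R * (k%:R * y) ^+ n :> R.
  by rewrite natrM natrX exprMn mulrA.
have ky0 : 0 <= k%:R * y by rewrite mulr_ge0.
have [ky1|ky1] := ltP (k%:R * y) 1.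
(* [cvg_natM_expr] wants a positive base. When [k y = 0] and n > 0, either k = 0 makes the exponent
   vanish or y = 0 makes the base equal to 1. *)
- have [ky00|kyN0] := eqVneq (k%:R * y) 0.
    apply: cvg_near_cst; near=> n.
    have n0 : (0 < n)%N by near: n; exact: nbhs_infty_gt.
    move/eqP : ky00; rewrite mulf_eq0 pnatr_eq0 => /orP[|] /eqP ->.
      by rewrite exp0n// muln0 expr0.
    by rewrite expr0n gtn_eqF// subr0 expr1n.
  (* Below the threshold, the lower bound is Bernoulli at [- y^n]. *)
  apply: (@squeeze_cvgr _ _ _ _ (fun n => 1 - n%:R * (k%:R * y) ^+ n) (fun=> 1)).
  + apply: nearW => n; have /andP[yn0 yn1] := yn n; apply/andP; split.
      have := @bernoulli_ineq (- y ^+ n) (n * k ^ n); rewrite mulrN e.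
      by apply; lra.
    by rewrite exprn_ile1//; lra.
  + rewrite -[X in _ --> X]subr0; apply: cvgB; first exact: cvg_cst.
    by apply: cvg_natM_expr; rewrite lt0r kyN0 ky0.
  + exact: cvg_cst.
(* At or above the threshold, Bernoulli gives [(1 + y^n)^(n k^n) >= 1 + n (k y)^n >= n + 1]. Since
   [(1 - y^n) (1 + y^n) <= 1], the cutoff is at most [1 / (n + 1)]. *)
- apply: (@squeeze_cvgr _ _ _ _ (fun=> 0) harmonic).
  + apply: nearW => n; have /andP[yn0 yn1] := yn n; apply/andP; split.
      by rewrite exprn_ge0//; lra.
    rewrite /= -[leRHS]mul1r ler_pdivlMr ?ltr0n//.
    have /le_trans : n.+1%:R <= (1 + y ^+ n) ^+ (n * k ^ n).
      apply: le_trans (bernoulli_ineq _ _); last by lra.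
      rewrite e -natr1 addrC lerD2l ler_peMr//.
      by rewrite exprn_ege1.
    have p0 : 0 <= (1 - y ^+ n) ^+ (n * k ^ n) by rewrite exprn_ge0//; lra.
    move=> /(_ _ (lexx _)) /(ler_wpM2l p0) /le_trans; apply.
    by rewrite -exprMn exprn_ile1//; nra.
  + exact: cvg_cst.
  + exact: cvg_harmonic.
Unshelve. all: by end_near. Qed.

End limits.

(** * Integrals with a known real value *)

Section has_integral.
Context d (T : measurableType d) {R : realType}.
Variables (mu : {measure set T -> \bar R}) (D : set T).
Hypothesis mD : measurable D.

(** Integrability is bundled with the value so that finite linear combinations can be integrated
    without separate side conditions. *)
Definition has_integral (f : T -> R) (v : R) : Prop :=
  mu.-integrable D (EFin \o f) /\ (\int[mu]_(x in D) (f x)%:E = v%:E)%E.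

Lemma has_integral_eq f g v : {in D, f =1 g} -> has_integral f v ->
  has_integral g v.
Proof.
move=> fg [intf fv]; split.
  by apply: eq_integrable intf => // x /fg /= ->.
by rewrite -fv; apply: eq_integral => x /fg ->.
Qed.

Lemma has_integral0 : has_integral (fun=> 0) 0.
Proof. by split; [exact: integrable0 | exact: integral0]. Qed.

Lemma has_integralD f g v w : has_integral f v -> has_integral g w ->
  has_integral (fun x => f x + g x) (v + w).
Proof.
move=> [intf fv] [intg gw]; split; first exact: (integrableD mD intf intg).
by under eq_integral do rewrite EFinD; rewrite integralD// fv gw.
Qed.

Lemma has_integralZ c f v : has_integral f v ->
  has_integral (fun x => c * f x) (c * v).
Proof.
move=> [intf fv]; split; first exact: (integrableZl mD c intf).
by under eq_integral do rewrite EFinM; rewrite integralZl// fv.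
Qed.

Lemma has_integral_sum I (s : seq I) (f : I -> T -> R) (v : I -> R) :
  (forall i, has_integral (f i) (v i)) ->
  has_integral (fun x => \sum_(i <- s) f i x) (\sum_(i <- s) v i).
Proof.
move=> fv; elim: s => [|i s IH].
  rewrite big_nil; apply: has_integral_eq has_integral0 => x _.
  by rewrite big_nil.
rewrite big_cons; apply: has_integral_eq (has_integralD (fv i) IH) => x _.
by rewrite big_cons.
Qed.

End has_integral.

(** * Integrals of powers, with and without a logarithm, over (0,1) *)

Section unit_interval_integrals.
Context {R : realType}.

Let is_derive_exprn (n : nat) (x : R) :
  is_derive x 1 (fun y => y ^+ n) (n%:R * x ^+ n.-1).
Proof.
by split; [exact: exprn_derivable | rewrite exp_derive [_ *: 1]mulr1].
Qed.

Local Notation leb := (@lebesgue_measure R).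
Local Notation I01 := (`]0%R, 1%R[%classic : set (measurableTypeR R)).

Lemma has_integral_expr k :
  has_integral leb I01 (fun x => x ^+ k) k.+1%:R^-1.
Proof.
have cX : continuous (fun x : R => x ^+ k) by exact: exprn_continuous.
split.
  apply: (@integrableS _ _ R leb `[0, 1]%classic) => //.
    by move=> x /=; rewrite !in_itv/= => /andP[? ?]; rewrite !ltW.
  apply: continuous_compact_integrable; first exact: segment_compact.
  exact: continuous_subspaceT.
rewrite -(@integral_itv_bndoo _ 0 1 _ true false); last first.
  by apply/measurable_EFinP; exact: exprn_measurable.
rewrite (@continuous_FTC2 _ _ (fun x => k.+1%:R^-1 * x ^+ k.+1)) //.
- by rewrite expr1n mulr1 expr0n/= mulr0 sube0.
- exact: continuous_subspaceT.
- have cF : continuous (fun x : R => k.+1%:R^-1 * x ^+ k.+1).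
    by move=> x; apply: cvgM; [exact: cvg_cst | exact: exprn_continuous].
  split.
  + move=> x _; apply: derivableM => //; exact: exprn_derivable.
  + by apply: cvg_at_right_filter; exact: cF.
  + by apply: cvg_at_left_filter; exact: cF.
- move=> x _; rewrite derive1E deriveZ; last exact: exprn_derivable.
  by rewrite exp_derive /GRing.scale/= mulr1 mulKf.
Qed.

(** The logarithm is singular at 0, so the fundamental theorem is applied on [[e n, 1]]. Monotone
    convergence, available because the integrand is nonnegative there, then passes to []0, 1]]. *)
Lemma has_integral_expr_ln k :
  has_integral leb I01 (fun x => - (x ^+ k * ln x)) (k.+1%:R ^- 2).
Proof.
pose f (x : R) := - (x ^+ k * ln x).
(* An antiderivative of [f] for x > 0; [F 1] is the claimed value and [F] tends to 0 at 0. *)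
pose F (x : R) := k.+1%:R ^- 2 * x ^+ k.+1 - k.+1%:R^-1 * (x ^+ k.+1 * ln x).
have cf (x : R) : 0 < x -> {for x, continuous f}.
  move=> x0; apply: cvgN; apply: cvgM; first exact: exprn_continuous.
  exact: continuous_ln.
have dF (x : R) : 0 < x -> is_derive x 1 F (f x).
  move=> x0; 
  have dX := is_derive_exprn k.+1 x; have dL := is_derive1_ln x0.
  have d1 := is_deriveZ (k.+1%:R ^- 2) dX.
  have d2 := is_deriveZ (k.+1%:R ^-1) (is_deriveM dX dL).
  have d12 : is_derive x 1 F _ := is_deriveB d1 d2.
  apply: is_derive_eq d12 _; rewrite /f /GRing.scale/= [x ^+ k.+1]exprS.
  have : k.+1%:R != 0 :> R by rewrite pnatr_eq0.
  by move: k.+1%:R => c c0; field; rewrite c0 gt_eqF.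
have cF (x : R) : 0 < x -> {for x, continuous F}.
  move=> x0; apply: differentiable_continuous; apply/derivable1_diffP.
  by case: (dF x x0).
(* Dyadic endpoints turn [e n * ln (e n)] into a constant times [(n + 1) / 2^(n + 1)], a case of
   [cvg_natM_expr]. Starting at 1/2 keeps every endpoint below 1. *)
pose e n : R := 2^-1 ^+ n.+1.
have e0 n : 0 < e n by rewrite exprn_gt0// invr_gt0.
have e1 n : e n < 1 by rewrite exprn_ilt1 ?invr_ge0//; lra.
have mf : measurable_fun setT (f : measurableTypeR R -> measurableTypeR R).
  apply: measurable_funN; apply: measurable_funM; first exact: exprn_measurable.
  exact: measurable_ln.
have FTC n : (\int[leb]_(x in `[e n, 1%R]) (f x)%:E = (F 1)%:E - (F (e n))%:E)%E.
  apply: continuous_FTC2 => //.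
  - apply: continuous_in_subspaceT => x; rewrite inE/= in_itv/= => /andP[ex _].
    by apply: cf; exact: lt_le_trans ex.
  - split.
    + move=> x; rewrite in_itv/= => /andP[ex _].
      by case: (dF _ (lt_trans (e0 n) ex)).
    + by apply: cvg_at_right_filter; exact: cF.
    + by apply: cvg_at_left_filter; exact: cF.
  - move=> x; rewrite in_itv/= => /andP[ex _]; rewrite derive1E.
    by case: (dF _ (lt_trans (e0 n) ex)).
have f0 (x : R) : 0 < x <= 1 -> 0 <= f x.
  move=> /andP[x0 x1]; rewrite oppr_ge0 mulr_ge0_le0 ?ln_le0//.
  by rewrite exprn_ge0// ltW.
have ecvg : e n @[n --> \oo] --> 0.
  have : (2^-1 : R) ^+ n @[n --> \oo] --> 0.
    by apply: cvg_expr; rewrite gtr0_norm ?invr_gt0//; lra.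
  by rewrite -cvg_shiftS.
have U : \bigcup_n `[e n, 1]%classic = `]0, 1]%classic :> set R.
  apply/seteqP; split => [x [n _ /=]|x /=]; rewrite !in_itv/= => /andP[ex x1].
    by rewrite (lt_le_trans _ ex).
  move: ecvg => /cvgr0_norm_lt /(_ _ ex)[n _ /(_ n (leqnn n))].
  by rewrite gtr0_norm// => /ltW enx; exists n => //=; rewrite in_itv/= enx x1.
have Fe : F (e n) @[n --> \oo] --> 0.
  have eX m : e n ^+ m @[n --> \oo] --> (0 : R) ^+ m.
    elim: m => [|m IH]; first by rewrite expr0; exact: cvg_cst.
    by rewrite exprS; under eq_fun do rewrite exprS; exact: cvgM.
  have eln : e n * ln (e n) @[n --> \oo] --> 0.
    rewrite -[X in _ --> X](mulr0 (- ln 2)).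
    under eq_fun => n.
      rewrite lnXn ?invr_gt0// lnV ?posrE// mulrC -[_ *+ n.+1]mulr_natr -mulrA.
      over.
    apply: cvgM; first exact: cvg_cst.
    rewrite (cvg_shiftS (fun n => n%:R * (2^-1 : R) ^+ n : R)).
    by apply: cvg_natM_expr; rewrite invr_gt0 ltr0n/=; lra.
  rewrite /F -[X in _ --> X]subr0; apply: cvgB.
    rewrite -[X in _ --> X](mulr0 (k.+1%:R ^- 2)); apply: cvgM; first exact: cvg_cst.
    by have := eX k.+1; rewrite expr0n.
  rewrite -[X in _ --> X](mulr0 (k.+1%:R^-1)); apply: cvgM; first exact: cvg_cst.
  have -> : (fun n => e n ^+ k.+1 * ln (e n)) =
      (fun n => e n ^+ k * (e n * ln (e n))).
    by apply/funext => n; rewrite exprSr mulrA.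
  have := cvgM (eX k) eln; rewrite mulr0; apply.
have If : (\int[leb]_(x in I01) (f x)%:E = (k.+1%:R ^- 2)%:E)%E.
  rewrite -(@integral_itv_bndoo _ 0 1 _ false false); last first.
    by apply/measurable_EFinP; exact: measurable_funTS.
  have /cvg_unique : (\int[leb]_(x in `[e n, 1%R]) (f x)%:E)%E @[n --> \oo] -->
      (\int[leb]_(x in `]0%R, 1%R]) (f x)%:E)%E.
    rewrite -U; apply: ge0_nondecreasing_set_cvg_integral => //.
    - apply/nondecreasing_seqP => n; rewrite subsetEset => x /=.
      rewrite !in_itv/= => /andP[ex ->]; rewrite andbT (le_trans _ ex)//.
      by rewrite /e exprS ler_piMl ?exprn_ge0//; lra.
    - by move=> n; apply/measurable_EFinP; exact: measurable_funTS.
    - move=> n x /=; rewrite in_itv/= => /andP[ex x1]; rewrite lee_fin f0//.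
      by rewrite (lt_le_trans _ ex).
  apply => //.
  have -> : (fun n => \int[leb]_(x in `[e n, 1%R]) (f x)%:E)%E =
      (fun n => (F 1 - F (e n))%:E).
    by apply/funext => n; rewrite FTC EFinB.
  apply: cvg_EFin; first exact: nearW.
  rewrite -[X in _ --> X]subr0; apply: cvgB => //.
  rewrite /F expr1n ln1 !mulr0 subr0 mulr1; exact: cvg_cst.
(* As [f] is nonnegative on (0,1), the integral of its norm is the finite value just found. *)
split => //; apply/integrableP; split.
  by apply/measurable_EFinP; exact: measurable_funTS.
rewrite (_ : (\int[_]_(x in _) _ = (k.+1%:R ^- 2)%:E)%E) ?ltry//.
rewrite -If; apply: eq_integral => x; rewrite inE/= in_itv/= => /andP[x0 x1].
by rewrite /= ger0_norm// f0// x0 ltW.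
Qed.

End unit_interval_integrals.

(** * Splitting a square double sum along its diagonals *)

Section double_sums.
Context {V : nmodType}.
Implicit Types F : nat -> nat -> V.

(** Column [n + 1] meets each diagonal of the strict triangle in its last entry. Peeling it off is
    the induction step of [big_square_diagonals]. *)
Lemma big_upper_triangle n F :
  \sum_(0 <= i < n.+1) \sum_(0 <= j < n.+1 - i) F j (j + i + 1)%N =
  \sum_(0 <= i < n) \sum_(0 <= j < n - i) F j (j + i + 1)%N +
  \sum_(0 <= j < n.+1) F j n.+1.
Proof.
transitivity (\sum_(0 <= i < n.+1)
    (\sum_(0 <= j < n - i) F j (j + i + 1)%N + F (n - i)%N n.+1)).
  apply: eq_big_nat => i; rewrite ltnS => /andP[_ lein].
  by rewrite subSn// big_nat_recr//= subnK// addn1.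
rewrite big_split/= big_nat_recr//= subnn [X in _ + X + _]big_geq// addr0.
congr (_ + _); rewrite [RHS]big_nat_rev/=.
by apply: eq_bigr => i _; rewrite add0n subSS.
Qed.

(** The three parts match the three sums of [square_density], with [i + 1] the distance to the main
    diagonal. The induction adds a last row and column; the lower triangle is the upper one of the
    transpose. *)
Lemma big_square_diagonals n F :
  \sum_(0 <= j < n.+1) \sum_(0 <= k < n.+1) F j k =
  \sum_(0 <= i < n) \sum_(0 <= j < n - i) F j (j + i + 1)%N
  + \sum_(0 <= i < n.+1) F i i
  + \sum_(0 <= i < n) \sum_(0 <= j < n - i) F (j + i + 1)%N j.
Proof.
elim: n => [|n IH]; first by rewrite !big_nat1 !big_geq// add0r addr0.
rewrite big_upper_triangle (big_upper_triangle n (fun j k => F k j)).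
rewrite [LHS]big_nat_recr//= [X in _ + X = _]big_nat_recr//=.
under eq_bigr do rewrite big_nat_recr//=.
rewrite big_split/= IH [X in _ = _ + X + _]big_nat_recr//=.
by rewrite [LHS](AC (3*1*2) ((1*4)*(2*6)*(3*5)))/=.
Qed.

End double_sums.

(** * The density as a double sum, and its moments *)

Section density_moments.
Context {R : realType}.
Local Notation leb := (@lebesgue_measure R).
Local Notation I01 := (`]0%R, 1%R[%classic : set (measurableTypeR R)).

(* The multiplicative convolution of [x ^+ j] and [x ^+ k] on (0,1). *)
Definition expr_conv (j k : nat) (x : R) : R :=
  if j == k then - (x ^+ j * ln x) else (x ^+ j - x ^+ k) / (k%:R - j%:R).

Lemma expr_convC j k x : expr_conv j k x = expr_conv k j x.
Proof.
rewrite /expr_conv eq_sym; case: eqVneq => [->//|_].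
by rewrite -mulrNN -invrN !opprB.
Qed.

(** For [k = j + i + 1], the factor [(1 - x^(i+1)) / (i+1)] times [x^j] is [expr_conv j k x].
    Positivity of x serves to clear the negative powers of the third sum. *)
Lemma square_densityE n (a : nat -> R) x : 0 < x ->
  square_density n a x =
  \sum_(0 <= j < n.+1) \sum_(0 <= k < n.+1) a j * a k * expr_conv j k x.
Proof.
move=> x0; rewrite big_square_diagonals /square_density; congr (_ + _ + _).
- apply: eq_bigr => i _; rewrite mulr_sumr; apply: eq_bigr => j _.
  rewrite /expr_conv -[X in X == _]addn0 -addnA eqn_add2l addn1/=.
  rewrite natrD [_ - j%:R]addrC addKr exprD.
  by rewrite mulrC mulrACA mulrBr !mulrA; ring.
- rewrite -mulNr mulr_sumr; apply: eq_bigr => i _.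
  by rewrite /expr_conv eqxx expr2; ring.
(* With m = i + 2 and the inner index shifted by i + 1, the term is [x^(j+i+1) (1 - x^-(i+1)) /
   -(i+1) = (x^j - x^(j+i+1)) / (i+1)]. *)
- rewrite big_add1 big_add1 /=; apply: eq_big_nat => i lein.
  rewrite -[X in \sum_(X <= _ < _) _]add0n big_addn/= subSS mulr_sumr.
  apply: eq_bigr => j _.
  have -> : ((j + i.+1).+1 - i.+2)%N = j by lia.
  rewrite expr_convC /expr_conv -[X in X == _]addn0 -addnA eqn_add2l addn1/=.
  rewrite natrD [_ - j%:R]addrC addKr exprD.
  have -> : 1 - i.+2%:Z = - i.+1%:Z by lia.
  have -> : 1 - i.+2%:R = - i.+1%:R :> R by rewrite -natr1; ring.
  have xi0 : x ^+ i.+1 != 0 by rewrite expf_neq0// gt_eqF.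
  have i0 : i.+1%:R != 0 :> R by rewrite pnatr_eq0.
  have -> : x ^ (- i.+1%:Z) = (x ^+ i.+1)^-1 by [].
  move: i.+1%:R (x ^+ i.+1) i0 xi0 => c y c0 y0.
  by field; rewrite c0.
Qed.

(** Off the diagonal this is a partial fraction: [1/(p+j+1) - 1/(p+k+1)] is [k - j] times the
    product of the two fractions. On the diagonal it is the logarithmic integral with exponent
    [p + k]. *)
Lemma has_integral_expr_conv p j k :
  has_integral leb I01 (fun x => x ^+ p * expr_conv j k x)
    ((p + j).+1%:R^-1 * (p + k).+1%:R^-1).
Proof.
have mI : measurable I01 by exact: measurable_itv.
rewrite /expr_conv; case: eqVneq => [->|jk].
  rewrite -expr2 exprVn.
  apply: (has_integral_eq mI _ (has_integral_expr_ln (p + k))).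
  move=> x _ /=. by rewrite exprD mulrN mulrA.
have kj0 : k%:R - j%:R != 0 :> R by rewrite subr_eq0 eqr_nat eq_sym.
pose c : R := (k%:R - j%:R)^-1.
have := has_integralD mI
  (has_integralZ mI c (has_integral_expr (p + j)))
  (has_integralZ mI (- c) (has_integral_expr (p + k))).
have -> : c * (p + j).+1%:R^-1 + - c * (p + k).+1%:R^-1 =
    (p + j).+1%:R^-1 * (p + k).+1%:R^-1.
  have ne0 m : 1 + (p%:R + m%:R) != 0 :> R.
    by rewrite -natrD nat1r pnatr_eq0.
  by rewrite /c; field; rewrite !ne0 kj0.
by apply: (has_integral_eq mI) => x _ /=; rewrite !exprD -/c; ring.
Qed.

(** The moment of each [expr_conv j k] factors into a j-part and a k-part, so the double sum is a
    perfect square: that of the p-th moment of the polynomial with coefficients [a]. *)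
Lemma has_integral_square_density n (a : nat -> R) p :
  has_integral leb I01 (fun x => x ^+ p * square_density n a x)
    ((\sum_(0 <= i < n.+1) a i / (p + i).+1%:R) ^+ 2).
Proof.
have mI : measurable I01 by exact: measurable_itv.
rewrite expr2 big_distrlr/=.
have h j k := has_integralZ mI (a j * a k) (has_integral_expr_conv p j k).
have := has_integral_sum mI (index_iota 0 n.+1)
  (fun j => has_integral_sum mI (index_iota 0 n.+1) (h j)).
under eq_bigr do under eq_bigr do rewrite mulrACA.
apply: (has_integral_eq mI) => x; rewrite inE/= in_itv/= => /andP[x0 _].
rewrite square_densityE// mulr_sumr; apply: eq_bigr => j _.
by rewrite mulr_sumr; apply: eq_bigr => k _; rewrite mulrCA.
Qed.

End density_moments.

(** * From equal moments on [0,M] to equality on Borel sets *)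

Section moment_determinacy.
Context {R : realType}.
Local Notation leb := (@lebesgue_measure R).
Local Notation B := (measurableTypeR R).

Variables (m : {finite_measure set B -> \bar R}) (f : B -> R) (M : R).
Local Notation D := (`[0%R, M]%classic : set B).
Hypothesis M0 : 0 < M.
Hypothesis intf : leb.-integrable D (EFin \o f).
Hypothesis moments : forall k,
  (\int[m]_(x in D) (x ^+ k)%:E = \int[leb]_(x in D) (x ^+ k * f x)%:E)%E.

Let mD : measurable D. Proof. exact: measurable_itv. Qed.

Let mf : measurable_fun D f.
Proof. by apply/measurable_EFinP; exact: measurable_int intf. Qed.

Let horner_bound (p : {poly R}) : exists c, forall x, D x -> `|p.[x]| <= c.
Proof.
exists (\sum_(i < size p) `|p`_i| * M ^+ i) => x; rewrite /= in_itv/=.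
move=> /andP[x0 xM]; rewrite horner_coef (le_trans (ler_norm_sum _ _ _))//.
apply: ler_sum => i _; rewrite normrM ler_wpM2l// normrX ger0_norm//.
by rewrite lerXn2r ?nnegrE// ltW.
Qed.

Let measurable_horner (p : {poly R}) : measurable_fun D (fun x : B => p.[x]).
Proof.
apply: measurable_funTS; apply: continuous_measurable_fun.
exact: continuous_horner.
Qed.

Let integrable_horner (p : {poly R}) : m.-integrable D (fun x : B => p.[x]%:E).
Proof.
have [c pc] := horner_bound p.
apply: (le_integrable mD _ _ (finite_measure_integrable_cst m c mD)) => //.
- by apply/measurable_EFinP; exact: measurable_horner.
- by move=> x Dx /=; rewrite lee_fin (le_trans (pc _ Dx))// ler_norm.
Qed.

Let integrable_hornerM (p : {poly R}) :
  leb.-integrable D (fun x : B => (p.[x] * f x)%:E).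
Proof.
have [c pc] := horner_bound p.
apply: (le_integrable mD _ _ (integrableZl mD c intf)) => //.
- by apply/measurable_EFinP; apply: measurable_funM.
- move=> x Dx /=; rewrite lee_fin !normrM ler_wpM2r//.
  by rewrite (le_trans (pc _ Dx))// ler_norm.
Qed.

Let integral_horner (p : {poly R}) :
  (\int[m]_(x in D) (p.[x])%:E = \int[leb]_(x in D) (p.[x] * f x)%:E)%E.
Proof.
under eq_integral do rewrite horner_coef -sumEFin.
under [RHS]eq_integral do rewrite horner_coef mulr_suml -sumEFin.
have iX k : m.-integrable D (fun x : B => (x ^+ k)%:E).
  by apply: eq_integrable (integrable_horner 'X^k) => // x _; rewrite hornerXn.
have iXf k : leb.-integrable D (fun x : B => (x ^+ k * f x)%:E).
  by apply: eq_integrable (integrable_hornerM 'X^k) => // x _; rewrite hornerXn.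
rewrite integral_sum//; last first.
  by move=> i; exact: (integrableZl mD p`_i (iX i)).
rewrite integral_sum//; last first.
  move=> i; apply: eq_integrable (integrableZl mD p`_i (iXf i)) => // x _.
  by rewrite -EFinM mulrA.
apply: eq_bigr => i _.
under eq_integral do rewrite EFinM.
under [RHS]eq_integral do rewrite -mulrA EFinM.
by rewrite !integralZl// moments.
Qed.

Let measure_itvNyo c : 0 < c ->
  (m (D `&` `]-oo, c[) = \int[leb]_(x in D `&` `]-oo, c[) (f x)%:E)%E.
Proof.
move=> c0.
(* Taking [k c >= M] keeps [x / (k c)] in [0,1] for x in [D], as [cvg_cutoff] requires; k times this
   quotient is below 1 exactly when x < c. *)
have [k k0 kcM] : exists2 k : nat, (0 < k)%N & M <= k%:R * c.
  have Mc0 : 0 <= M / c by rewrite divr_ge0// ltW.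
  exists (Num.bound (M / c)); last by rewrite -ler_pdivrMr// ltW// archi_boundP.
  by rewrite -(ltr0n R) (le_lt_trans Mc0)// archi_boundP.
have k0R : 0 < k%:R :> R by rewrite ltr0n.
pose p n : {poly R} := (1 - ((k%:R * c)^-1 *: 'X) ^+ n) ^+ (n * k ^ n).
have pE n x : (p n).[x] = (1 - (x / (k%:R * c)) ^+ n) ^+ (n * k ^ n).
  by rewrite /p !hornerE mulrC.
have ye01 (x : R) : D x -> 0 <= x / (k%:R * c) <= 1.
  rewrite /= in_itv/= => /andP[x0 xM].
  rewrite divr_ge0 ?mulr_ge0 ?(ltW c0)//=.
  by rewrite ler_pdivrMr ?mulr_gt0// mul1r (le_trans xM).
have pcvg (x : R) : D x -> (p n).[x] @[n --> \oo] --> (\1_(`]-oo, c[) x : R).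
  move=> Dx; under eq_fun do rewrite pE.
  have := @cvg_cutoff R k _ (ye01 _ Dx).
  rewrite invfM mulrCA mulVKf ?gt_eqF// ltr_pdivrMr// mul1r.
  by rewrite indicE mem_setE in_itv.
have p01 n (x : R) : D x -> `|(p n).[x]| <= 1.
  move=> /ye01; rewrite pE => /andP[y0 y1].
  rewrite normrX exprn_ile1// ger0_norm ?subr_ge0 ?exprn_ile1//.
  by rewrite lerBlDr lerDl exprn_ge0.
have mI : measurable (`]-oo, c[%classic : set B) by exact: measurable_itv.
have [_ _ cvgm] := @dominated_convergence _ B R m D mD
  (fun n x => ((p n).[x])%:E) (fun x => (\1_(`]-oo, c[) x)%:E) (cst 1%E)
  (fun n => measurable_int _ (integrable_horner (p n)))
  ltac:(by apply/measurable_EFinP; exact: measurable_indic)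
  ltac:(by apply: aeW => x Dx; apply: cvg_EFin; [exact: nearW | exact: pcvg])
  (finite_measure_integrable_cst m 1 mD)
  ltac:(by apply: aeW => x n Dx; rewrite lee_fin p01).
(* The same cutoffs integrated against [f], now dominated by the norm of [f]. *)
have [_ _ cvgf] := @dominated_convergence _ B R leb D mD
  (fun n x => ((p n).[x] * f x)%:E) (fun x => (\1_(`]-oo, c[) x * f x)%:E)
  (abse \o (EFin \o f))
  (fun n => measurable_int _ (integrable_hornerM (p n)))
  ltac:(by apply/measurable_EFinP; apply: measurable_funM => //;
    exact: measurable_indic)
  ltac:(by apply: aeW => x Dx; apply: cvg_EFin;
    [exact: nearW | apply: cvgMl; exact: pcvg])
  (integrable_abse intf)
  ltac:(by apply: aeW => x n Dx; rewrite lee_fin normrM ler_piMl// p01).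
move: cvgm; have -> : [sequence (\int[m]_(x in D) ((p n).[x])%:E)%E]_n =
    [sequence (\int[leb]_(x in D) ((p n).[x] * f x)%:E)%E]_n.
  by apply/funext => n; exact: integral_horner.
move=> /(cvg_unique (@ereal_hausdorff R)) /(_ cvgf).
rewrite integral_indic// setIC => ->.
rewrite setIC integral_mkcondl; apply: eq_integral => x _.
by rewrite patchE indicE; case: ifPn; rewrite (mul1r,mul0r).
Qed.

Lemma moments_determine_density A : measurable A ->
  (m (D `&` A) = \int[leb]_(x in D `&` A) (f x)%:E)%E.
Proof.
move=> mA.
pose g : B -> \bar R := (EFin \o f) \_ D.
have ig : leb.-integrable setT g by exact: (integrable_mkcond _ mD).1 intf.
have mg : measurable_fun setT g := measurable_int _ ig.
have gE C : (\int[leb]_(x in D `&` C) (f x)%:E = \int[leb]_(x in C) g x)%E.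
  by rewrite integral_mkcondl.
pose gp A := (\int[leb]_(x in A) g^\+ x)%E.
pose gn A := (\int[leb]_(x in A) g^\- x)%E.
have gp_ge0 C : (0 <= gp C)%E by apply: integral_ge0 => x _; exact: funepos_ge0.
have gn_ge0 C : (0 <= gn C)%E by apply: integral_ge0 => x _; exact: funeneg_ge0.
pose mgp := isMeasure.Build _ _ _ gp (integral_set0 _ _) gp_ge0
  (semi_sigma_additive_nng_induced (measurable_funepos mg) (@funepos_ge0 _ _ g)).
pose mgn := isMeasure.Build _ _ _ gn (integral_set0 _ _) gn_ge0
  (semi_sigma_additive_nng_induced (measurable_funeneg mg) (@funeneg_ge0 _ _ g)).
pose Gp : {measure set B -> \bar R} := HB.pack gp mgp.
pose Gn : {measure set B -> \bar R} := HB.pack gn mgn.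
pose m1 := measure_add (mrestr m mD) Gn.
have ipos C : measurable C -> leb.-integrable C g^\+%E.
  by move=> mC; apply: integrable_funepos => //; exact: integrableS ig.
have ineg C : measurable C -> leb.-integrable C g^\-%E.
  by move=> mC; apply: integrable_funeneg => //; exact: integrableS ig.
have gpn C : measurable C -> (\int[leb]_(x in C) g x = gp C - gn C)%E.
  by move=> mC; rewrite integralE.
have finn C : measurable C -> gn C \is a fin_num.
  by move=> mC; exact: integrable_fin_num (ineg C mC).
have m1v C : m1 C = (m (D `&` C) + gn C)%E.
  by rewrite /m1 measure_addE setIC.
(* The negative part has finite mass, so it can be moved across the equation in either direction. *)
have m1E C : measurable C -> (m1 C = Gp C) <->
    (m (D `&` C) = \int[leb]_(x in D `&` C) (f x)%:E)%E.
  move=> mC; rewrite m1v gE gpn// (_ : Gp C = gp C)//.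
  by split => [<-|->]; [rewrite addeK// finn | rewrite subeK// finn].
apply/(m1E _ mA).
(* Open left rays form a pi-system generating the Borel sets, and the rays with natural endpoints
   exhaust the line with finite mass. *)
apply: (@measure_unique _ R B (@RGenInftyO.G R)
  (fun n => `]-oo, n%:R[%classic)) => //.
- exact: RGenInftyO.measurableE.
- move=> _ _ [x ->] [y ->]; exists (Num.min x y).
  by apply/seteqP; split => z /=; rewrite !in_itv/= lt_min => /andP.
- by move=> n; exists n%:R.
- apply/seteqP; split => // x _; exists (Num.bound (`|x| : R)) => //=.
  by rewrite in_itv/= (le_lt_trans (ler_norm x))// archi_boundP.
- move=> _ [c ->]; apply/m1E; first exact: measurable_itv.
  (* For c <= 0 the open ray misses [0,M], and both sides vanish. *)
  have [c0|c0] := ltP 0 c; first exact: measure_itvNyo.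
  have -> : D `&` `]-oo, c[ = set0.
    apply/seteqP; split => // x [/=]; rewrite !in_itv/= => /andP[x0 _].
    by rewrite ltNge (le_trans c0).
  by rewrite measure0 integral_set0.
- move=> n; suff : (m1 `]-oo, n%:R[%classic < +oo)%E by [].
  have mn : measurable (`]-oo, n%:R[%classic : set B) by exact: measurable_itv.
  rewrite m1v lte_add_pinfty// -ge0_fin_numE// ?finn//.
  by apply: fin_num_measure; exact: measurableI.
Qed.
End moment_determinacy.

(** * Finite measures on the line: support, densities and moments *)

Section finite_measure_integrals.
Context {R : realType}.
Local Notation leb := (@lebesgue_measure R).
Local Notation B := (measurableTypeR R).
Variable m : {finite_measure set B -> \bar R}.

Lemma integrable_expr_bounded (D : set B) c k : measurable D ->
  (forall x, D x -> `|x| <= c) -> m.-integrable D (fun x => (x ^+ k)%:E).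
Proof.
move=> mD Dc.
apply: (le_integrable mD _ _ (finite_measure_integrable_cst m (c ^+ k) mD)) => //.
- by apply/measurable_EFinP; exact: exprn_measurable.
- move=> x Dx /=; rewrite lee_fin !normrX lerXn2r ?nnegrE//.
  by rewrite (le_trans (Dc _ Dx))// ler_norm.
Qed.

Lemma integral_expr_support (D : set B) c k : measurable D ->
  (forall x, D x -> `|x| <= c) -> m (~` D) = 0%E ->
  (\int[m]_x (x ^+ k)%:E = \int[m]_(x in D) (x ^+ k)%:E)%E.
Proof.
move=> mD Dc mDC.
have mCD := measurableC mD.
have TD : setT `\` ~` D = D by rewrite setTD setCK.
rewrite (negligible_integral mCD) ?TD//.
apply/(negligible_integrable mCD) => //.
  by apply/measurable_EFinP; exact: exprn_measurable.
by rewrite TD; exact: integrable_expr_bounded Dc.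
Qed.

(** Integrals over Lebesgue-null sets vanish, whence absolute continuity. The derivative and [h] are
    then integrable functions with the same integral over every Borel set, so they agree almost
    everywhere. *)
Lemma density_Radon_Nikodym (h : B -> \bar R) :
  leb.-integrable setT h ->
  (forall A, measurable A -> m A = \int[leb]_(x in A) h x)%E ->
  m `<< leb /\ ae_eq leb setT ('d (charge_of_finite_measure m) '/d leb) h.
Proof.
move=> ih mh.
have mleb : m `<< leb.
  apply/null_content_dominatesP => A mA A0; rewrite mh//.
  apply: null_set_integral => //.
  by apply: measurable_funTS; exact: measurable_int ih.
split => //; apply: integral_ae_eq => //.
- exact: Radon_Nikodym_integrable.
- exact: measurable_int ih.
- by move=> A _ mA; rewrite -mh// -Radon_Nikodym_integral.
Qed.

(** Turns moments of a measure into Lebesgue integrals, as needed for [nu]: change of variables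
    produces the derivative, which is [h] almost everywhere. *)
Lemma integral_expr_density (h : B -> \bar R) (D : set B) c k :
  measurable D -> (forall x, D x -> `|x| <= c) ->
  leb.-integrable setT h ->
  (forall A, measurable A -> m A = \int[leb]_(x in A) h x)%E ->
  (\int[m]_(x in D) (x ^+ k)%:E = \int[leb]_(x in D) ((x ^+ k)%:E * h x))%E.
Proof.
move=> mD Dc ih mh; have [mleb dh] := density_Radon_Nikodym ih mh.
rewrite -(Radon_Nikodym_change_of_variables mleb)//; last first.
  exact: integrable_expr_bounded Dc.
have mX : measurable_fun D (fun x : B => (x ^+ k)%:E).
  by apply/measurable_EFinP; exact: exprn_measurable.
apply: ae_eq_integral => //.
- apply: emeasurable_funM => //; apply: measurable_funTS.
  by apply: (measurable_int leb); exact: Radon_Nikodym_integrable.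
- apply: emeasurable_funM => //.
  by apply: measurable_funTS; exact: measurable_int ih.
- by apply: filterS dh => x /(_ I) dhx _; rewrite dhx.
Qed.

End finite_measure_integrals.

(** * Moments of [nu], localization of [mu], and identification of the derivative *)

Theorem theorem3p3 (R : realType) (n : nat) (a : nat -> R)
  (g : {poly R}) (hg : g = \poly_(i < n.+1) a i)
  (g_pos : forall x : R, 0 <= x <= 1 -> 0 < g.[x])
  (nu : probability (measurableTypeR R) R)
  (hnu : forall A : set (measurableTypeR R), measurable A ->
    nu A = (\int[lebesgue_measure]_(t in A) (g.[t] * \1_`]0%R, 1%R[ t)%:E)%E)
  (mu : {finite_measure set (measurableTypeR R) -> \bar R})
  (hmu : is_square nu mu) :
  mu `<< (@lebesgue_measure R) /\
  ae_eq (@lebesgue_measure R) setT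
    ('d (charge_of_finite_measure mu) '/d (@lebesgue_measure R))
    (fun x => (square_density n a x * \1_`]0%R, 1%R[ x)%:E).
Proof.
pose B := measurableTypeR R.
pose leb := @lebesgue_measure R.
pose I01 : set B := `]0%R, 1%R[%classic.
have mI : measurable I01 by exact: measurable_itv.
have I01_norm (x : B) : I01 x -> `|x| <= 1.
  by rewrite /I01/= in_itv/= => /andP[x0 x1]; rewrite ger0_norm ltW.
have restrI (f : B -> R) (D : set B) : I01 `<=` D ->
    (\int[leb]_(x in D) (f x * \1_I01 x)%:E = \int[leb]_(x in I01) (f x)%:E)%E.
  move=> ID; rewrite -[in RHS](setIidl ID) integral_mkcondl.
  apply: eq_integral => x _; rewrite patchE indicE.
  by case: ifPn; rewrite (mulr1, mulr0).
have integrableI (f : B -> R) : leb.-integrable I01 (EFin \o f) ->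
    leb.-integrable setT (fun x => (f x * \1_I01 x)%:E).
  move=> /(integrable_mkcond _ mI).1; apply: eq_integrable => // x _.
  by rewrite patchE indicE; case: ifPn; rewrite (mulr1, mulr0).
(* The k-th moment of [nu], in the form that is squared in [has_integral_square_density]. *)
pose c k := \sum_(0 <= i < n.+1) a i / (k + i).+1%:R.
have g_moment k : has_integral leb I01 (fun x => x ^+ k * g.[x]) (c k).
  have := has_integral_sum mI (index_iota 0 n.+1) (fun i =>
    has_integralZ mI (a i) (has_integral_expr (k + i))).
  apply: (has_integral_eq mI) => x _.
  rewrite hg horner_poly big_mkord mulr_sumr; apply: eq_bigr => i _.
  by rewrite exprD mulrCA.
have nu_moment k : (\int[nu]_x (x ^+ k)%:E = (c k)%:E)%E.
  have ig : leb.-integrable setT (fun x => (g.[x] * \1_I01 x)%:E).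
    (* The zeroth moment carries the integrability of [g] itself. *)
    have [+ _] := g_moment 0; move=> h; apply: integrableI.
    by apply: eq_integrable h => // x _ /=; rewrite expr0 mul1r.
  rewrite (integral_expr_support k mI I01_norm); last first.
    apply: etrans (hnu _ (measurableC mI)) _.
    by apply: integral0_eq => x nIx; rewrite indicE memNset ?mulr0.
  rewrite (integral_expr_density k mI I01_norm ig hnu).
  rewrite -(g_moment k).2 -[RHS](restrI _ I01)//.
  by apply: eq_integral => x _; rewrite -EFinM mulrA.
have [[K [cK K0 muK]] mu_moment] := hmu.
have [N [_ KN]] := compact_bounded cK.
(* [compact_bounded] accepts any bound exceeding [N]. The choice also ensures [1 <= M], so that
   (0,1) lies in [0,M]. *)
pose M := `|N| + 1.
have M1 : 1 <= M by rewrite lerDr.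
have KM x : K x -> `|x| <= M.
  by apply: KN; rewrite (le_lt_trans (ler_norm N))// ltrDl.
pose D : set B := `[0, M]%classic.
have mD : measurable D by exact: measurable_itv.
have D_norm (x : B) : D x -> `|x| <= M.
  by rewrite /D/= in_itv/= => /andP[x0 xM]; rewrite ger0_norm.
have ID : I01 `<=` D.
  move=> x; rewrite /I01 /D /= !in_itv/= => /andP[x0 x1].
  by rewrite ltW//= (le_trans (ltW x1)).
have KD : K `<=` D.
  move=> x Kx; have := K0 _ Kx; rewrite /D /= !in_itv/= andbT => x0.
  by rewrite x0/= (le_trans (ler_norm x))// KM.
have muD : mu (~` D) = 0%E.
  apply/eqP; rewrite eq_le measure_ge0 andbT -muK.
  apply: le_measure; rewrite ?inE; [exact: measurableC| |exact: subsetC].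
  by apply: measurableC; exact: compact_measurable.
pose f x := square_density n a x * \1_I01 x.
have intf : leb.-integrable setT (EFin \o f).
  have [+ _] := has_integral_square_density n a 0; move=> h.
  apply: integrableI; apply: eq_integrable h => // x _ /=.
  by rewrite expr0 mul1r.
(* Both sides equal the square of [c k]. *)
have moments k : (\int[mu]_(x in D) (x ^+ k)%:E =
    \int[leb]_(x in D) (x ^+ k * f x)%:E)%E.
  rewrite -(integral_expr_support k mD D_norm muD) mu_moment nu_moment.
  rewrite -EFin_expe -(has_integral_square_density n a k).2.
  rewrite -[LHS](restrI _ D)//.
  by apply: eq_integral => x _; rewrite /f mulrA.
apply: (density_Radon_Nikodym intf) => A mA.
have M0 : 0 < M by exact: lt_le_trans M1.
have intfD := integrableS measurableT mD (@subsetT _ D) intf.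
(* The part of [A] outside [D] is null for [mu]. *)
have muDA : mu A = mu (D `&` A).
  rewrite -[in LHS](setIT A) -(setUv D) setIUr measureU//; last first.
  - by rewrite setIACA setICr setI0.
  - by apply: measurableI => //; exact: measurableC.
  - exact: measurableI.
  rewrite [X in (_ + X)%E](subset_measure0 _ _ _ muD) ?adde0 1?setIC//.
  - by apply: measurableI => //; exact: measurableC.
  - exact: measurableC.
rewrite muDA (moments_determine_density M0 intfD moments mA) integral_mkcondl.
(* Off [D] the density vanishes, because (0,1) lies in [D]. *)
apply: eq_integral => x _; rewrite patchE; case: ifPn => // xD.
rewrite /= /f indicE memNset ?mulr0// => /ID Dx.
by move: xD; rewrite mem_set.
Qed.
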